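(* Let $n\ge2$, let $c=(c_{i,j})$ be an $n\times(n+1)$ matrix with entries in $\{0,1\}$, $\sigma_1,\ldots,\sigma_n>0$, $\gamma_1,\ldots,\gamma_{n+1}>0$. Let $\mathbf{X}=(X_1,\ldots,X_n)'$ have decumulative distribution function \[ \mathbf{P}[X_1>x_1,\ldots,X_n>x_n]=\prod_{j=1}^{n+1}\left(1+\sum_{i=1}^n\frac{c_{i,j}}{\sigma_i}x_i\right)^{-\gamma_j},\quad (x_1,\ldots,x_n)'\in(0,\infty)^n. \] For $1\le k\ne l\le n$ let $\gamma^\ast_{c,k}=\sum_jc_{k,j}\gamma_j$, $\gamma^\ast_{c,l}=\sum_jc_{l,j}\gamma_j$ and $\gamma_{c,(k,l)}=\sum_{j=1}^{n+1}c_{k,j}c_{l,j}\gamma_j$. If $\gamma^\ast_{c,k}>2$ and $\gamma^\ast_{c,l}>2$, then \[ \mathbf{Cov}[X_k,X_l]=\frac{\sigma_k\sigma_l}{(\gamma^\ast_{c,k}-1)(\gamma^\ast_{c,l}-1)}\left({}_3F_2\left(\gamma_{c,(k,l)},1,1;\gamma^\ast_{c,k},\gamma^\ast_{c,l};1\right)-1\right). \]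
   Context: The generalized hypergeometric function is ${}_{q+1}F_q(a_1,\ldots,a_{q+1};b_1,\ldots,b_q;z)=\sum_{k=0}^\infty\frac{(a_1)_k\cdots(a_{q+1})_k}{(b_1)_k\cdots(b_q)_k}\frac{z^k}{k!}$, with $(a)_k=\Gamma(a+k)/\Gamma(a)$ the Pochhammer symbol. *)

(* Defs.v *)
From HB Require Import structures.
From mathcomp Require Import all_boot all_order all_algebra.
From mathcomp Require Import all_classical all_reals all_analysis.
Set Implicit Arguments. Unset Strict Implicit. Unset Printing Implicit Defensive.
Import Order.TTheory GRing.Theory Num.Theory.
Local Open Scope ring_scope.

Definition pochhammer (R : realType) (a : R) (k : nat) : R :=
  \prod_(i < k) (a + i%:R).

Definition hypergeom_term (R : realType) (as_ bs : seq R) (z : R) (k : nat) : R :=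
  (\prod_(a <- as_) pochhammer a k) / (\prod_(b <- bs) pochhammer b k)
  * z ^+ k / (k`!)%:R.

Definition hypergeom (R : realType) (as_ bs : seq R) (z : R) : R :=
  limn (fun N : nat => \sum_(0 <= k < N) hypergeom_term as_ bs z k).

(* Main.v *)
Require Import Defs.
From HB Require Import structures.
From mathcomp Require Import all_boot all_order all_algebra.
From mathcomp Require Import all_classical all_reals all_analysis.
From mathcomp Require Import measurable_realfun ring lra.
Import Order.TTheory GRing.Theory Num.Theory.
Import numFieldNormedType.Exports.
Local Open Scope classical_set_scope.
Local Open Scope ring_scope.
Set Implicit Arguments.
Unset Strict Implicit.
Unset Printing Implicit Defensive.

(** For nonnegative variables E[XY] is the integral over s, t >= 0 of
    P(X > s, Y > t).  With u = s / sigma_k, v = t / sigma_l the joint survival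
    function of (X_k, X_l) is
      (1 + u)^-(gk - g) (1 + v)^-(gl - g) (1 + u + v)^-g,
    and since 1 + u + v = (1 + u) (1 + v) (1 - w) with
    w = u / (1 + u) * (v / (1 + v)), it equals
      (1 + u)^-gk (1 + v)^-gl (1 - w)^-g.
    Expanding (1 - w)^-g as a binomial series with nonnegative terms separates
    the variables; the remaining integrals are Beta integrals, and integrating
    term by term yields the series 3F2(g, 1, 1; gk, gl; 1). *)

(** * Pochhammer symbols and the binomial series *)

Lemma pochhammerS (R : realType) (a : R) k :
  pochhammer a k.+1 = pochhammer a k * (a + k%:R).
Proof. by rewrite /pochhammer big_ord_recr. Qed.

Lemma pochhammer_ge0 (R : realType) (a : R) k : 0 <= a -> 0 <= pochhammer a k.
Proof. by move=> a0; apply: prodr_ge0 => i _; rewrite addr_ge0. Qed.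

Lemma pochhammer_gt0 (R : realType) (a : R) k : 0 < a -> 0 < pochhammer a k.
Proof. by move=> a0; apply: prodr_gt0 => i _; rewrite ltr_pwDl. Qed.

Lemma pochhammer1 (R : realType) k : pochhammer (1 : R) k = k`!%:R.
Proof.
elim: k => [|k IH]; first by rewrite /pochhammer big_ord0.
by rewrite pochhammerS IH factS mulnC natrM -natr1 addrC.
Qed.

Lemma ler_pochhammer (R : realType) (a b : R) k :
  0 <= a -> a <= b -> pochhammer a k <= pochhammer b k.
Proof.
by move=> a0 ab; apply: ler_prod => i _; rewrite addr_ge0 //= lerD2r.
Qed.

Lemma pochhammer_shift (R : realType) (a : R) k :
  pochhammer a k.+1 = a * pochhammer (a + 1) k.
Proof.
rewrite /pochhammer big_ord_recl addr0; congr (_ * _).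
by apply: eq_bigr => i _; rewrite /= /bump add1n -natr1 addrA addrAC.
Qed.

Lemma is_derive_powR_1B (R : realType) (g w : R) : w < 1 ->
  is_derive w 1 (fun x => (1 - x) `^ g) (- (g * (1 - w) `^ (g - 1))).
Proof.
move=> w1; have w0 : 0 < 1 - w by rewrite subr_gt0.
rewrite (_ : (fun x => _) = (fun y : R => y `^ g) \o (fun x : R => 1 - x)) //.
have ? := is_derive1_powR g w0; apply: is_derive_eq.
by rewrite /=; ring.
Qed.

(** The coefficient of x^m in the expansion of (1 - x)^-g. *)
Definition negbin (R : realType) (g : R) (m : nat) : R := pochhammer g m / m`!%:R.

Lemma negbin_ge0 (R : realType) (g : R) m : 0 <= g -> 0 <= negbin g m.
Proof. by move=> g0; rewrite divr_ge0 // pochhammer_ge0. Qed.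

Lemma negbinS (R : realType) (g : R) m :
  m.+1%:R * negbin g m.+1 = (g + m%:R) * negbin g m.
Proof.
rewrite /negbin pochhammerS factS natrM; field.
by rewrite nat1r !pnatr_eq0 -lt0n fact_gt0.
Qed.

(** The derivative of (1 - x)^-g is g (1 - x)^-(g + 1); this is the same identity read off
    coefficientwise. *)
Lemma negbin_shift (R : realType) (g : R) m :
  m.+1%:R * negbin g m.+1 = g * negbin (g + 1) m.
Proof.
rewrite /negbin pochhammer_shift factS natrM; field.
by rewrite nat1r !pnatr_eq0 -lt0n fact_gt0.
Qed.

Definition negbin_sum (R : realType) (g : R) (N : nat) (x : R) : R :=
  \sum_(0 <= m < N) negbin g m * x ^+ m.

(** The recursion [negbinS] makes the product rule telescope, so that only the top-degree term
    survives. No infinite series has to be differentiated. *)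
Lemma is_derive_negbin_sumM (R : realType) (g w : R) N : w < 1 ->
  is_derive w 1 (fun x => negbin_sum g N.+1 x * (1 - x) `^ g)
    (- (N.+1%:R * negbin g N.+1 * w ^+ N * (1 - w) `^ (g - 1))).
Proof.
move=> w1; have w0 : 0 < 1 - w by rewrite subr_gt0.
have dg := is_derive_powR_1B g w1.
(* Gives both terms of the product rule the common factor (1 - w)^(g - 1). *)
have pE : (1 - w) `^ g = (1 - w) * (1 - w) `^ (g - 1).
  rewrite -{2}[1 - w]powRr1 ?ltW // -powRD; last by rewrite (gt_eqF w0) implybT.
  by congr (_ `^ _); ring.
elim: N => [|N IH].
  rewrite (_ : (fun x => _) = (fun x => (1 - x) `^ g)); last first.
    apply/funext => x; rewrite /negbin_sum big_nat1 /negbin /pochhammer.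
    by rewrite big_ord0 fact0 expr0 divr1 !mul1r.
  apply: is_derive_eq.
  by rewrite negbinS /negbin /pochhammer big_ord0 expr0 fact0; field.
have h2 : is_derive w 1 (fun x => negbin g N.+1 * x ^+ N.+1 * (1 - x) `^ g)
    (negbin g N.+1 * (N.+1%:R * w ^+ N) * (1 - w) `^ g
      - negbin g N.+1 * w ^+ N.+1 * (g * (1 - w) `^ (g - 1))).
  have hM : is_derive w 1 (fun x => negbin g N.+1 * x ^+ N.+1)
      (negbin g N.+1 * (N.+1%:R * w ^+ N)).
    rewrite (_ : (fun x => _) = horner (negbin g N.+1 *: 'X^(N.+1))).
      by apply: is_derive_eq; rewrite derivZ derivXn hornerZ hornerMn hornerXn mulr_natl.
    by apply/funext => x; rewrite hornerZ hornerXn.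
  have := is_deriveM hM dg; rewrite mulrfctE => hMg.
  apply: is_derive_eq.
  by rewrite /GRing.scale /=; ring.
rewrite (_ : (fun x => _) = (fun x => negbin_sum g N.+1 x * (1 - x) `^ g)
    + (fun x => negbin g N.+1 * x ^+ N.+1 * (1 - x) `^ g)); last first.
  apply/funext => x; rewrite /GRing.add /=.
  by rewrite /negbin_sum big_nat_recr //= mulrDl.
have hD := is_deriveD IH h2; apply: is_derive_eq.
by rewrite (negbinS g N.+1) pE !exprS; ring.
Qed.

(* Mean value theorem on [0, w]; the remainder tends to 0 because, by
   [negbin_shift], it is bounded by a term of the convergent series with
   parameter g + 1. *)
Lemma negbin_sum_remainder (R : realType) (g w : R) N : 0 <= w < 1 ->
  exists2 c, 0 <= c <= w &
    negbin_sum g N.+1 w * (1 - w) `^ g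
    = 1 - N.+1%:R * negbin g N.+1 * c ^+ N * (1 - c) `^ (g - 1) * w.
Proof.
move=> /andP[w0 w1].
have der (x : R) : x <= w -> _ :=
  fun h => @is_derive_negbin_sumM R g x N (le_lt_trans h w1).
have le_w (x : R) : x \in `]0, w[ -> x <= w by rewrite in_itv => /andP[_ /ltW].
have [|c] := @MVT_segment R _ _ 0 w w0 (fun x h => der x (le_w x h)).
  apply: derivable_within_continuous => x; rewrite in_itv /= => /andP[_ /der ?].
  exact: ex_derive.
rewrite in_itv /= subr0 subr0 powR1 mulr1 => c0w.
have -> : negbin_sum g N.+1 0 = 1.
  rewrite /negbin_sum big_nat_recl //= big1_seq ?addr0 => [|i _].
    by rewrite expr0 mulr1 /negbin /pochhammer big_ord0 fact0 divr1.
  by rewrite exprS mul0r mulr0.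
by move=> /eqP; rewrite subr_eq => /eqP h; exists c => //; rewrite h mulNr addrC.
Qed.

(** The mean value form subtracts a nonnegative remainder from 1, so the partial sum times (1 - w)^g
    is at most 1. *)
Lemma negbin_sum_le (R : realType) (g w : R) N : 0 <= g -> 0 <= w < 1 ->
  negbin_sum g N w <= (1 - w) `^ (- g).
Proof.
move=> g0 w01; case/andP: (w01) => w0 w1.
case: N => [|N]; first by rewrite /negbin_sum big_geq // powR_ge0.
have w'0 : 0 < 1 - w by rewrite subr_gt0.
rewrite powRN -[_^-1]mul1r ler_pdivlMr ?powR_gt0 //.
have [c /andP[c0 _] ->] := negbin_sum_remainder g N w01.
by rewrite lerBlDr lerDl !mulr_ge0 ?powR_ge0 ?exprn_ge0 ?pochhammer_ge0.
Qed.

Lemma is_cvg_negbin_sum (R : realType) (g w : R) : 0 <= g -> 0 <= w < 1 ->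
  cvgn (fun N => negbin_sum g N w).
Proof.
move=> g0 w01; case/andP: (w01) => w0 w1.
apply: nondecreasing_is_cvgn.
  apply/nondecreasing_seqP => n; rewrite /negbin_sum big_nat_recr //= lerDl.
  by rewrite mulr_ge0 ?exprn_ge0 ?negbin_ge0.
by exists ((1 - w) `^ (- g)) => _ [n _ <-]; exact: negbin_sum_le.
Qed.

(** It suffices that the partial sum times (1 - w)^g tends to 1. The intermediate point c of the
    remainder varies with N, so the squeeze needs a bound uniform in c. *)
Lemma cvg_negbin_sum (R : realType) (g w : R) : 0 <= g -> 0 <= w < 1 ->
  negbin_sum g N w @[N --> \oo] --> (1 - w) `^ (- g).
Proof.
move=> g0 w01; case/andP: (w01) => w0 w1.
have w'0 : 0 < 1 - w by rewrite subr_gt0.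
(* On [0, w] the function (1 - c)^(g - 1) is monotone, hence bounded by the larger of its values at
   c = 0 and c = w. *)
pose C := Num.max 1 ((1 - w) `^ (g - 1)).
have t0 : g * (negbin (g + 1) N * w ^+ N) * C * w @[N --> \oo] --> 0.
  have h : negbin (g + 1) N * w ^+ N @[N --> \oo] --> 0.
    by apply: cvg_series_cvg_0; apply: is_cvg_negbin_sum => //; rewrite addr_ge0.
  rewrite -[X in _ --> X](_ : g * 0 * C * w = 0); last by rewrite mulr0 !mul0r.
  by do 2 apply: cvgMr_tmp; apply: cvgMl_tmp.
rewrite -(cvg_shiftS (fun N => negbin_sum g N w)) /=.
have -> : (fun N => negbin_sum g N.+1 w)
    = (fun N => negbin_sum g N.+1 w * (1 - w) `^ g * (1 - w) `^ (- g)).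
  apply/funext => N; rewrite -mulrA -powRD ?subrr ?powRr0 ?mulr1 //.
  by rewrite (gt_eqF w'0) implybT.
suff h : negbin_sum g N.+1 w * (1 - w) `^ g @[N --> \oo] --> (1 : R).
  by have := cvgMr_tmp (b := (1 - w) `^ (- g)) h; rewrite mul1r; exact.
apply: (@squeeze_cvgr _ _ _ _
  (fun N => 1 - g * (negbin (g + 1) N * w ^+ N) * C * w) (cst 1)); last 2 first.
- by have := cvgB (cvg_cst (1 : R)) t0; rewrite subr0; exact.
- exact: cvg_cst.
apply: nearW => N; have [c /andP[c0 cw] ->] := negbin_sum_remainder g N w01.
have c'0 : 0 < 1 - c by rewrite subr_gt0 (le_lt_trans cw).
have cC : (1 - c) `^ (g - 1) <= C.
  rewrite le_max; have [g1|g1] := leP 1 g.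
    apply/orP; left; rewrite [leRHS](_ : 1 = 1 `^ (g - 1)); last by rewrite powR1.
    apply: ge0_ler_powR; rewrite ?nnegrE ?(ltW c'0) ?subr_ge0 //.
    by rewrite gerDl oppr_le0.
  rewrite -[g - 1]opprB !powRN lef_pV2 ?posrE ?powR_gt0 //.
  apply/orP; right; apply: ge0_ler_powR.
  - by rewrite subr_ge0 ltW.
  - by rewrite nnegrE ltW.
  - by rewrite nnegrE ltW.
  - by rewrite lerD2l lerN2.
rewrite negbin_shift; apply/andP; split; last first.
  by rewrite gerDl oppr_le0 !mulr_ge0 ?powR_ge0 ?exprn_ge0 ?pochhammer_ge0 ?addr_ge0.
rewrite lerD2l lerN2 ler_wpM2r //.
have a0 : 0 <= negbin (g + 1) N by rewrite negbin_ge0 ?addr_ge0.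
apply: ler_pM; rewrite ?powR_ge0 // ?mulr_ge0 ?exprn_ge0 ?pochhammer_ge0 ?addr_ge0 //.
by rewrite -mulrA !ler_wpM2l // lerXn2r ?nnegrE.
Qed.

(** * Beta integrals *)

Lemma is_derive_powR_1D (R : realType) (a u : R) : -1 < u ->
  is_derive u 1 (fun x => (1 + x) `^ a) (a * (1 + u) `^ (a - 1)).
Proof.
move=> u1; have u0 : 0 < 1 + u by rewrite -ltrBlDl sub0r.
rewrite (_ : (fun x => _) = (fun y : R => y `^ a) \o (fun x : R => 1 + x)) //.
have ? := is_derive1_powR a u0; apply: is_derive_eq.
by rewrite add0r !mulr1.
Qed.

(** Substitute y = 1 / (1 + u), which tends to 0 through positive values, into the one-sided limit
    of y^p at 0. *)
Lemma cvg_powR_1D_y (R : realType) (p : R) : 0 < p ->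
  (1 + u) `^ (- p) @[u --> +oo] --> 0.
Proof.
move=> p0; apply/cvgrPdist_lt => e e0.
have : @powR R ^~ p a @[a --> 0^'+] --> 0 by exact: powR_cvg0.
move/cvgrPdist_lt => /(_ e e0); rewrite near_withinE => h.
have cV : (fun u : R => (1 + u)^-1) @ +oo --> 0.
  apply/gtr0_cvgV0.
    by near=> u; rewrite ltr_pwDl //; near: u; exact: nbhs_pinfty_ge.
  apply/cvgryPge => A; near=> u.
  rewrite -lerBlDl; near: u; apply: nbhs_pinfty_ge; exact: num_real.
have hu := cV _ h; near=> u.
have u0 : 0 < 1 + u by rewrite ltr_pwDl //; near: u; exact: nbhs_pinfty_ge.
have -> : (1 + u) `^ (- p) = ((1 + u)^-1) `^ p.
  by rewrite -powR_inv1 ?ltW // -powRrM mulN1r.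
suff : 0 < (1 + u)^-1 -> `|0 - (1 + u)^-1 `^ p| < e by apply; rewrite invr_gt0.
by near: u; exact: hu.
Unshelve. all: by end_near. Qed.

(** The unnormalised density of the beta prime law with parameters m + 1 and g - 1. *)
Definition betaprime (R : realType) (g : R) (m : nat) (u : R) : R :=
  u ^+ m * (1 + u) `^ (- (g + m%:R)).

(* The recursion is integration by parts; the constant in the base case makes
   the primitive vanish at +oo. *)
Fixpoint betaprime_primitive (R : realType) (g : R) (m : nat) (u : R) : R :=
  if m is m'.+1 then
    (m%:R * betaprime_primitive g m' u - u ^+ m * (1 + u) `^ (- (g + m'%:R)))
      / (g + m'%:R)
  else - ((1 + u) `^ (1 - g) / (g - 1)).

(** Differentiating u^(m + 1) (1 + u)^-(g + m) yields (m + 1) [betaprime g m] - (g + m)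
    [betaprime g m.+1]. The inductive primitive cancels the first term. *)
Lemma is_derive_betaprime_primitive (R : realType) (g u : R) m :
  1 < g -> -1 < u ->
  is_derive u 1 (betaprime_primitive g m) (betaprime g m u).
Proof.
move=> g1 u1; have u0 : 0 < 1 + u by rewrite -ltrBlDl sub0r.
have g0 : 0 < g by exact: lt_trans g1.
elim: m => [|m IH].
  have h := is_derive_powR_1D (1 - g) u1.
  rewrite (_ : betaprime_primitive g 0
      = (- (g - 1)^-1) \*: (fun x => (1 + x) `^ (1 - g))); last first.
    by apply/funext => x /=; rewrite /GRing.scale /= mulNr mulrC.
  apply: is_derive_eq.
  rewrite /GRing.scale /= /betaprime expr0 mul1r addr0 addrAC subrr add0r.
  by field; rewrite subr_eq0 gt_eqF.
have gm : g + m%:R != 0 by rewrite gt_eqF // ltr_pwDl.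
have h := is_derive_powR_1D (- (g + m%:R)) u1.
have hX : is_derive u 1 (fun x : R => x ^+ m.+1) (m.+1%:R * u ^+ m).
  rewrite (_ : (fun x => _) = horner ('X^(m.+1))).
    by apply: is_derive_eq; rewrite derivXn hornerMn hornerXn mulr_natl.
  by apply/funext => x; rewrite hornerXn.
have hM := is_deriveM hX h.
have hZ := is_deriveZ m.+1%:R IH.
have hB := is_deriveZ (g + m%:R)^-1 (is_deriveB hZ hM).
rewrite (_ : betaprime_primitive g m.+1 = (g + m%:R)^-1 \*:
   (m.+1%:R \*: betaprime_primitive g m -
    (fun x => x ^+ m.+1) * (fun x => (1 + x) `^ (- (g + m%:R))))); last first.
  by apply/funext => x /=; rewrite /GRing.scale /= mulrC.
apply: is_derive_eq.
rewrite /GRing.scale /= /betaprime.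
have -> : (1 + u) `^ (- (g + m%:R)) = (1 + u) * (1 + u) `^ (- (g + m%:R) - 1).
  rewrite -{2}[1 + u]powRr1 ?ltW // -powRD; last by rewrite (gt_eqF u0) implybT.
  by congr (_ `^ _); ring.
have -> : - (g + m.+1%:R) = - (g + m%:R) - 1 by rewrite -natr1; ring.
by rewrite !exprS; field.
Qed.

(** At 0 the boundary terms vanish, and each recursion step multiplies by (m + 1) / (g + m). The
    result is minus the Beta value B(m + 1, g - 1). *)
Lemma betaprime_primitive0 (R : realType) (g : R) m : 1 < g ->
  betaprime_primitive g m 0 = - (m`!%:R / ((g - 1) * pochhammer g m)).
Proof.
move=> g1; have g0 : 0 < g by exact: lt_trans g1.
have g10 : g - 1 != 0 by rewrite subr_eq0 gt_eqF.
elim: m => [|m IH] /=.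
  by rewrite addr0 powR1 /pochhammer big_ord0 mulr1.
rewrite IH exprS !mul0r subr0 pochhammerS factS natrM; field.
by rewrite g10 !gt_eqF ?ltr_pwDl ?pochhammer_gt0.
Qed.

Lemma cvg_betaprime_primitive (R : realType) (g : R) m : 1 < g ->
  betaprime_primitive g m u @[u --> +oo] --> 0.
Proof.
move=> g1; have g10 : 0 < g - 1 by rewrite subr_gt0.
have c1 : (1 + u) `^ (1 - g) @[u --> +oo] --> 0.
  by rewrite -[1 - g]opprB; exact: cvg_powR_1D_y.
elim: m => [|m IH] /=.
  have := cvgN (cvgMr_tmp (b := (g - 1)^-1) c1); rewrite mul0r oppr0; exact.
suff c2 : u ^+ m.+1 * (1 + u) `^ (- (g + m%:R)) @[u --> +oo] --> 0.
  have := cvgMr_tmp (b := (g + m%:R)^-1) (cvgB (cvgMl_tmp (a := m.+1%:R) IH) c2).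
  by rewrite mulr0 subr0 mul0r; exact.
(* Since u <= 1 + u, the boundary term is at most (1 + u)^(1 - g). *)
apply: (squeeze_cvgr _ (cvg_cst (0 : R)) c1).
near=> u.
have u0 : 0 <= u by near: u; exact: nbhs_pinfty_ge.
have u'0 : 0 < 1 + u by rewrite ltr_pwDl.
rewrite mulr_ge0 ?exprn_ge0 ?powR_ge0 //=.
have -> : (1 + u) `^ (1 - g) = (1 + u) ^+ m.+1 * (1 + u) `^ (- (g + m%:R)).
  rewrite -powR_mulrn ?ltW // -powRD; last by rewrite (gt_eqF u'0) implybT.
  by congr (_ `^ _); rewrite -natr1; ring.
by rewrite ler_wpM2r ?powR_ge0 // lerXn2r ?nnegrE ?lerDr ?ltW.
Unshelve. all: by end_near. Qed.

Lemma betaprime_ge0 (R : realType) (g : R) m u : 0 <= u -> 0 <= betaprime g m u.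
Proof. by move=> u0; rewrite mulr_ge0 ?exprn_ge0 ?powR_ge0. Qed.

Lemma derivable_betaprime (R : realType) (g u : R) m : -1 < u ->
  derivable (betaprime g m) u 1.
Proof.
move=> u1; have h := is_derive_powR_1D (- (g + m%:R)) u1.
apply: (@derivableM _ _ (fun x : R => x ^+ m) (fun x => (1 + x) `^ (- (g + m%:R)))).
  exact: exprn_derivable.
exact: ex_derive.
Qed.

Lemma is_derive_divr (R : realType) (s x : R) :
  is_derive x 1 (fun y : R => y / s) s^-1.
Proof.
rewrite (_ : (fun y => _) = s^-1 \*: id).
  by apply: is_derive_eq; rewrite /GRing.scale /= mulr1.
by apply/funext => y; rewrite /= mulrC.
Qed.

Lemma derivable_betaprime_scaled (R : realType) (g s x : R) m :
  0 < s -> 0 <= x -> derivable (fun y : R => betaprime g m (y / s)) x 1.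
Proof.
move=> s0 x0.
have h : is_derive (x / s) 1 (betaprime g m) (derive (betaprime g m) (x / s) 1).
  apply/derivableP/derivable_betaprime.
  by rewrite (lt_le_trans (ltrN10 _)) // divr_ge0 // ltW.
have hc := is_derive1_comp (g := fun y : R => y / s) h (is_derive_divr s x).
exact: (@ex_derive _ _ _ _ _ _ _ hc).
Qed.

Lemma integral_betaprime (R : realType) (g s : R) m : 1 < g -> 0 < s ->
  (\int[lebesgue_measure]_(x in `[0%R, +oo[) (betaprime g m (x / s))%:E
   = (s * (m`!%:R / ((g - 1) * pochhammer g m)))%:E)%E.
Proof.
move=> g1 s0.
have gt_m1 (x : R) : 0 <= x -> -1 < x / s.
  by move=> x0; rewrite (lt_le_trans (ltrN10 _)) // divr_ge0 // ltW.
(* The factor s compensates the 1 / s produced by the chain rule. *)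
pose F x := s * betaprime_primitive g m (x / s).
have dF (x : R) : 0 <= x -> is_derive x 1 F (betaprime g m (x / s)).
  move=> x0; have h := is_derive_betaprime_primitive m g1 (gt_m1 _ x0).
  have hc := is_derive1_comp (g := fun y : R => y / s) h (is_derive_divr s x).
  have hZ := is_deriveZ s hc.
  rewrite (_ : F = s \*: (betaprime_primitive g m \o (fun y : R => y / s))) //.
  by apply: is_derive_eq; rewrite /GRing.scale /= mulrC mulfVK ?gt_eqF.
rewrite (@ge0_continuous_FTC2y R _ F 0 0).
- by rewrite sub0e /F mul0r betaprime_primitive0 // mulrN EFinN oppeK.
- by move=> x x0; rewrite betaprime_ge0 // divr_ge0 // ltW.
- apply: derivable_within_continuous => x; rewrite in_itv /= andbT => x0.
  exact: derivable_betaprime_scaled.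
- rewrite -(mulr0 s); apply: cvgMl_tmp.
  apply: (cvg_comp _ _ _ (cvg_betaprime_primitive m g1)).
  apply/cvgryPge => A; near=> x; rewrite ler_pdivlMr //.
- by move=> x /ltW /dF ?; exact: ex_derive.
- apply: cvg_at_right_filter; apply: differentiable_continuous.
  by apply/derivable1_diffP; have ? := dF 0 (lexx 0); exact: ex_derive.
- move=> x; rewrite in_itv /= andbT => /ltW /dF ?.
  by rewrite derive1E; exact: derive_val.
Unshelve. all: by end_near. Qed.

(** * Joint tail formula *)

Section mixed_moment.
Context d (T : measurableType d) (R : realType) (P : probability T R).
Local Open Scope ereal_scope.
Notation mu := (@lebesgue_measure R).

Lemma measurable_strict_supset (X : {RV P >-> R}) (s : R) :
  measurable [set w | (s < X w)%R].
Proof.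
rewrite (_ : [set w | _] = X @^-1` `]s, +oo[); first exact: measurable_funPTI.
by apply/seteqP; split => w /=; rewrite in_itv/= andbT.
Qed.

(** Write X as the integral over s >= 0 of the indicator of s < X and exchange integrals by Tonelli.
    For fixed s, the one-variable tail formula applies to Y restricted to the event s < X. *)
Lemma integralM_joint_ccdf (X Y : {RV P >-> R}) :
  (forall w, 0 <= X w)%R -> (forall w, 0 <= Y w)%R ->
  \int[P]_w (X w * Y w)%:E =
  \int[mu]_(s in `[0%R, +oo[) \int[mu]_(t in `[0%R, +oo[)
     P [set w | (s < X w)%R /\ (t < Y w)%R].
Proof.
move=> X0 Y0.
pose GR := measurableTypeR R.
(* The section of [A] at w is [0, X w[, of length X w because X w >= 0. *)
pose A : set (T * GR) := [set p | (0 <= p.2 < X p.1)%R].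
have mA : measurable A.
  rewrite (_ : A = (fun p : T * GR => (0 <= p.2)%R) @^-1` [set true] `&`
                   (fun p : T * GR => (p.2 < X p.1)%R) @^-1` [set true]).
    apply: measurableI.
    - have : measurable_fun setT (fun p : T * GR => (0 <= p.2)%R).
        exact: measurable_fun_ler.
      by move=> /(_ measurableT [set true]); rewrite setTI; exact.
    - have : measurable_fun setT (fun p : T * GR => (p.2 < X p.1)%R).
        by apply: measurable_fun_ltr => //; exact: measurableT_comp.
      by move=> /(_ measurableT [set true]); rewrite setTI; exact.
  by apply/seteqP; split => p /= /andP.
transitivity (\int[P]_w \int[mu]_s (Y w * \1_A (w, s))%:E).
  apply: eq_integral => w _.
  under eq_integral do rewrite EFinM.
  rewrite ge0_integralZl //; last 2 first.
  - apply/measurable_EFinP.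
    exact: (measurableT_comp (measurable_indic mA) (@pair1_measurable _ _ T GR w)).
  - by rewrite lee_fin.
  rewrite EFinM muleC; congr (_ * _).
  rewrite (_ : (fun s => _) = (fun s => (\1_(`[0%R, X w[ : set R) s)%:E)).
    rewrite integral_indic // setIT /= lebesgue_measure_itv /= lte_fin.
    have := X0 w; rewrite le_eqVlt => /predU1P[<-|->]; first by rewrite ltxx.
    by rewrite sube0.
  apply/funext => s; congr (_%:E); rewrite !indicE; congr (_%:R).
have mf : measurable_fun setT (fun p : T * GR => (Y p.1 * \1_A p)%:E).
  apply/measurable_EFinP/measurable_funM; last exact: measurable_indic.
  exact: measurableT_comp.
rewrite (fubini_tonelli (m1 := P) (m2 := mu)
  (fun p : T * GR => (Y p.1 * \1_A p)%:E)) //; last first.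
  by move=> p; rewrite lee_fin mulr_ge0.
rewrite [RHS]integral_mkcond; apply: eq_integral => s _.
rewrite patchE; case: ifPn => [|]; last first.
  rewrite notin_setE /= in_itv /= andbT => /negP s0.
  apply: integral0_eq => w _; rewrite /= indicE memNset ?mulr0 //.
  by rewrite /A /= (negbTE s0).
rewrite inE /= in_itv /= andbT => s0.
have mXs := measurable_strict_supset X s.
(* For t >= 0 the event t < Z is exactly s < X and t < Y, because Z vanishes off the event s < X. *)
pose Z : {RV P >-> R} := (Y \* indic_mfun _ mXs)%R.
have Z0 w : (0 <= Z w)%R by rewrite /= mulr_ge0.
transitivity ('E_P[Z]).
  rewrite expectation_def; apply: eq_integral => w _ /=; congr (_ * _)%:E.
  rewrite !indicE; congr (_%:R); f_equal.
  by apply/idP/idP; rewrite !inE /A /= s0.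
rewrite ge0_expectation_ccdf //; apply: eq_integral => t.
rewrite inE /= in_itv /= andbT => t0.
rewrite /ccdf /distribution /pushforward; congr (P _).
apply/seteqP; split => w /=; rewrite in_itv /= andbT.
  rewrite mindicE; case: (boolP (w \in _)); first by rewrite inE /= mulr1.
  by rewrite mulr0 ltNge t0.
by move=> [sX tY]; rewrite mindicE mem_set // mulr1.
Qed.

End mixed_moment.

(** * Survival functions on the closed orthant *)

Section joint_survival.
Context d (T : measurableType d) (R : realType) (P : probability T R) (n : nat).
Variable X : 'I_n -> {RV P >-> R}.

Definition upper_orthant (x : 'I_n -> R) : set T := [set w | forall i, x i < X i w].

Lemma measurable_upper_orthant x : measurable (upper_orthant x).
Proof.
rewrite (_ : upper_orthant x = \bigcap_(i in setT) (X i @^-1` `]x i, +oo[)).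
  apply: fin_bigcap_measurable => [|i _]; first exact: finite_finset.
  exact: measurable_funPTI.
apply/seteqP; split => w /= h i; first by move=> _; rewrite /= in_itv /= h.
by have := h i I; rewrite /= in_itv /= andbT.
Qed.

(** Strict inequalities leave room, so the orthant is the increasing union of its shifts by 1 / (m +
    1); then use continuity of P from below. *)
Lemma cvg_upper_orthant x :
  P (upper_orthant (fun i => x i + m.+1%:R^-1)) @[m --> \oo]
    --> P (upper_orthant x).
Proof.
have -> : upper_orthant x = \bigcup_m upper_orthant (fun i => x i + m.+1%:R^-1).
  apply/seteqP; split => [w h|w [m _ h] i]; last first.
    by rewrite (lt_trans _ (h i)) // ltrDl.
  (* Each coordinate gets its own index; finitely many coordinates allow their maximum. *)
  have [N hN] := choice (fun i => ltr_add_invr (h i)).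
  exists (\max_i N i)%N => // i; apply: le_lt_trans (hN i).
  by rewrite lerD2l lef_pV2 ?posrE // ler_nat ltnS leq_bigmax.
apply: nondecreasing_cvg_mu.
- by move=> m; exact: measurable_upper_orthant.
- by apply: bigcup_measurable => m _; exact: measurable_upper_orthant.
- move=> a b ab; apply/subsetPset => w h i; apply: le_lt_trans (h i).
  by rewrite lerD2l lef_pV2 ?posrE // ler_nat ltnS.
Qed.

Variable S : ('I_n -> R) -> R.
Hypothesis PS : forall x, (forall i, 0 < x i) -> P (upper_orthant x) = (S x)%:E.
Hypothesis cS : forall x, (forall i, 0 <= x i) ->
  S (fun i => x i + m.+1%:R^-1) @[m --> \oo] --> S x.

(** The law is prescribed at strictly positive points only. Letting the shift 1 / (m + 1) tend to 0
    extends it to points with zero coordinates, which is how marginal laws are obtained. *)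
Lemma joint_survival_ge0 x : (forall i, 0 <= x i) ->
  P (upper_orthant x) = (S x)%:E.
Proof.
move=> x0; apply: (cvg_unique _ (@cvg_upper_orthant x)).
  exact: ereal_hausdorff.
rewrite (_ : (fun m => _) = EFin \o (fun m => S (fun i => x i + m.+1%:R^-1))).
  by apply: cvg_EFin; [exact: nearW|exact: cS].
by apply/funext => m; rewrite PS // => i; rewrite ltr_wpDl.
Qed.

Hypothesis S0 : S (fun=> 0) = 1.

Lemma upper_orthant0_negligible : P.-negligible (~` upper_orthant (fun=> 0)).
Proof.
have mA := measurable_upper_orthant (fun=> 0).
have PC : P (~` upper_orthant (fun=> 0)) = 0%E.
  by rewrite probability_setC // joint_survival_ge0 // S0 subee.
by apply/negligibleP; [exact: measurableC|exact: PC].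
Qed.

(** The part of B outside the positive orthant event is null, and inside that event B coincides with
    the orthant at x. *)
Lemma survival_pospart (B : set T) x : measurable B -> (forall i, 0 <= x i) ->
  (forall w, upper_orthant (fun=> 0) w -> B w <-> upper_orthant x w) ->
  P B = (S x)%:E.
Proof.
move=> mB x0 BE; rewrite -joint_survival_ge0 //.
have mx := measurable_upper_orthant x.
have m0 := measurable_upper_orthant (fun=> 0).
rewrite (measureDI P mB m0) [X in (X + _)%E](_ : _ = 0%E) ?add0e.
  congr (P _); apply/seteqP; split => w /=.
    by move=> [Bw w0]; apply/BE.
  move=> wx; have w0 : upper_orthant (fun=> 0) w.
    by move=> i; exact: le_lt_trans (wx i).
  by split => //; apply/BE.
apply: measure_negligible; first exact: measurableD.
exact: negligibleS upper_orthant0_negligible.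
Qed.

End joint_survival.

(** * The Pareto survival function and its bivariate margins *)

Definition pareto_survival (R : realType) (n : nat) (c : 'M[bool]_(n, n.+1))
    (sigma : 'I_n -> R) (gamma : 'I_n.+1 -> R) (x : 'I_n -> R) : R :=
  \prod_(j < n.+1)
    (1 + \sum_(i < n) (c i j)%:R / sigma i * x i) `^ (- gamma j).

Lemma cvg_pareto_survival (R : realType) (n : nat) (c : 'M[bool]_(n, n.+1))
    (sigma : 'I_n -> R) (gamma : 'I_n.+1 -> R) (x : 'I_n -> R) :
  (forall i, 0 < sigma i) -> (forall i, 0 <= x i) ->
  pareto_survival c sigma gamma (fun i => x i + m.+1%:R^-1) @[m --> \oo]
    --> pareto_survival c sigma gamma x.
Proof.
move=> s0 x0; apply: cvg_big => [|j _]; first exact: mul_continuous.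
pose y := 1 + \sum_(i < n) (c i j)%:R / sigma i * x i.
have y0 : 0 < y.
  by rewrite ltr_pwDl // sumr_ge0 // => i _; rewrite mulr_ge0 // divr_ge0 // ltW.
have cy : 1 + \sum_(i < n) (c i j)%:R / sigma i * (x i + m.+1%:R^-1) @[m --> \oo] --> y.
  (* The base is affine: a common shift h adds h times the sum of the coefficients. *)
  rewrite [X in X @ _](_ : _ = (fun m => y +
      (\sum_(i < n) (c i j)%:R / sigma i) * harmonic m)); last first.
    apply/funext => m; rewrite /y mulr_suml -addrA -big_split /=; congr (_ + _).
    by apply: eq_bigr => i _; rewrite mulrDr.
  have := cvgD (cvg_cst y)
    (cvgMl_tmp (a := \sum_(i < n) (c i j)%:R / sigma i) (@cvg_harmonic R)).
  by rewrite mulr0 addr0; exact.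
have ? := is_derive1_powR (- gamma j) y0.
have cp : {for y, continuous (fun z : R => z `^ (- gamma j))}.
  by apply/differentiable_continuous/derivable1_diffP; exact: ex_derive.
exact: (cvg_comp _ _ cy cp).
Qed.

Lemma prod_powR (R : realType) (I : Type) (r : seq I) (a : R) (f : I -> R) :
  0 < a -> \prod_(i <- r) a `^ f i = a `^ (\sum_(i <- r) f i).
Proof.
move=> a0; elim: r => [|i r IH]; first by rewrite !big_nil powRr0.
by rewrite !big_cons IH powRD // (gt_eqF a0) implybT.
Qed.

(** The identity holds factor by factor in j: the base is 1, 1 + u, 1 + v or 1 + u + v according to
    the entries c k j and c l j. *)
Lemma pareto_survival_pair (R : realType) (n : nat) (c : 'M[bool]_(n, n.+1))
    (sigma : 'I_n -> R) (gamma : 'I_n.+1 -> R) (k l : 'I_n) (s t : R) :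
  0 < sigma k -> 0 < sigma l -> k != l -> 0 <= s -> 0 <= t ->
  let u := s / sigma k in let v := t / sigma l in
  pareto_survival c sigma gamma
    (fun i => if i == k then s else if i == l then t else 0)
  = (1 + u) `^ (- \sum_(j < n.+1) (c k j)%:R * gamma j)
  * (1 + v) `^ (- \sum_(j < n.+1) (c l j)%:R * gamma j)
  * (1 - u / (1 + u) * (v / (1 + v)))
      `^ (- \sum_(j < n.+1) (c k j)%:R * (c l j)%:R * gamma j).
Proof.
move=> sk sl kl s0 t0 u v.
have u0 : 0 <= u by rewrite divr_ge0 // ltW.
have v0 : 0 <= v by rewrite divr_ge0 // ltW.
have u'0 : 0 < 1 + u by rewrite ltr_pwDl.
have v'0 : 0 < 1 + v by rewrite ltr_pwDl.
set w := 1 - _.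
have wE : w = (1 + u + v) / ((1 + u) * (1 + v)).
  by rewrite /w; field; rewrite !gt_eqF.
have w0 : 0 < w by rewrite wE divr_gt0 ?mulr_gt0 // -addrA ltr_pwDl ?addr_ge0.
rewrite -!sumrN -!prod_powR // -!big_split /=; apply: eq_bigr => j _.
have -> : \sum_(i < n) (c i j)%:R / sigma i *
    (if i == k then s else if i == l then t else 0)
    = (c k j)%:R * u + (c l j)%:R * v.
  rewrite (bigD1 k) //= eqxx (bigD1 l) //=; last by rewrite eq_sym.
  rewrite (eq_sym l k) (negbTE kl) eqxx big1 ?addr0 => [|i /andP[ik il]].
    by rewrite /u /v; ring.
  by rewrite (negbTE ik) (negbTE il) mulr0.
(* Only two equal entries need work: two ones use 1 + u + v = (1 + u) (1 + v) w, two zeros leave a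
   power of 1. *)
case: (c k j); case: (c l j);
  rewrite !(mul1r, mul0r, oppr0, powRr0, mulr1, addr0, add0r) //.
  by rewrite -!powRM ?mulr_ge0 ?ltW // wE; congr (_ `^ _); field; rewrite !gt_eqF.
by rewrite powR1.
Qed.

(** * Separation of the variables *)

Lemma betaprimeE (R : realType) (a u : R) m : 0 <= u ->
  betaprime a m u = (1 + u) `^ (- a) * (u / (1 + u)) ^+ m.
Proof.
move=> u0; have u'0 : 0 < 1 + u by rewrite ltr_pwDl.
rewrite /betaprime opprD powRD; last by rewrite (gt_eqF u'0) implybT.
by rewrite (powRN _ m%:R) powR_mulrn ?ltW // expr_div_n; ring.
Qed.

Lemma nneseries_negbin_betaprime (R : realType) (g a b u v : R) :
  0 <= g -> 0 <= u -> 0 <= v ->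
  (\sum_(m <oo) (negbin g m * betaprime a m u * betaprime b m v)%:E
   = ((1 + u) `^ (- a) * (1 + v) `^ (- b)
      * (1 - u / (1 + u) * (v / (1 + v))) `^ (- g))%:E)%E.
Proof.
move=> g0 u0 v0.
have [u'0 v'0] : 0 < 1 + u /\ 0 < 1 + v by rewrite !ltr_pwDl.
pose w := u / (1 + u) * (v / (1 + v)).
have w01 : 0 <= w < 1.
  rewrite mulr_ge0 ?divr_ge0 ?(ltW u'0) ?(ltW v'0) //=.
  by rewrite mulr_ilt1 ?divr_ge0 ?(ltW u'0) ?(ltW v'0) // ltr_pdivrMr ?mul1r ?ltrDr.
apply/cvg_lim => //.
rewrite (_ : (fun N => _) = EFin \o
    (fun N => (1 + u) `^ (- a) * (1 + v) `^ (- b) * negbin_sum g N w)); last first.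
  apply/funext => N /=; rewrite sumEFin; congr (_%:E).
  rewrite /negbin_sum mulr_sumr; apply: eq_bigr => m _.
  by rewrite !betaprimeE // [w ^+ m]exprMn; ring.
by apply: cvg_EFin; [exact: nearW|apply: cvgMl_tmp; exact: cvg_negbin_sum].
Qed.

(** * The series 3F2 at 1 *)

(** One of the two factors (1)_m = m! cancels the factorial built into the series. *)
Lemma hypergeom_term_3F2 (R : realType) (g a b : R) m :
  hypergeom_term [:: g; 1; 1] [:: a; b] 1 m
  = pochhammer g m * m`!%:R / (pochhammer a m * pochhammer b m).
Proof.
rewrite /hypergeom_term !big_cons !big_nil !mulr1 expr1n !pochhammer1 mulr1.
by rewrite mulrAC; congr (_ / _); rewrite mulrA mulfK.
Qed.

(* Telescoping: m! / (b)_m is the difference of consecutive values of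
   m! / (b)_m * ((b + m - 1) / (b - 2)). *)
Lemma sum_fact_div_pochhammer (R : realType) (b : R) N : 2 < b ->
  \sum_(0 <= m < N) m`!%:R / pochhammer b m
  = (b - 1) / (b - 2)
    - N`!%:R / pochhammer b N * ((b + N%:R - 1) / (b - 2)).
Proof.
move=> b2; have b0 : 0 < b by exact: lt_trans b2.
have b20 : b - 2 != 0 by rewrite subr_eq0 gt_eqF.
elim: N => [|N IH].
  by rewrite big_geq // /pochhammer big_ord0 fact0 addr0; field.
rewrite big_nat_recr //= IH pochhammerS factS natrM -natr1; field.
by rewrite b20 !gt_eqF ?ltr_pwDl ?pochhammer_gt0.
Qed.

(** As g <= a, the quotient (g)_m / (a)_m is at most 1, and the terms are dominated by m! / (b)_m,
    whose partial sums are bounded by telescoping when b > 2. *)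
Lemma is_cvg_hypergeom_3F2 (R : realType) (g a b : R) :
  0 <= g -> g <= a -> 0 < a -> 2 < b ->
  cvgn (fun N => \sum_(0 <= m < N) hypergeom_term [:: g; 1; 1] [:: a; b] 1 m).
Proof.
move=> g0 ga a0 b2; have b0 : 0 < b by exact: lt_trans b2.
apply: nondecreasing_is_cvgn.
  apply/nondecreasing_seqP => N; rewrite big_nat_recr //= lerDl hypergeom_term_3F2.
  by rewrite divr_ge0 ?mulr_ge0 ?pochhammer_ge0 ?(ltW a0) ?(ltW b0).
exists ((b - 1) / (b - 2)) => _ [N _ <-].
apply: (@le_trans _ _ (\sum_(0 <= m < N) m`!%:R / pochhammer b m)).
  apply: ler_sum => m _; rewrite hypergeom_term_3F2 invfM mulrACA.
  rewrite ler_piMl ?divr_ge0 ?pochhammer_ge0 ?(ltW b0) //.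
  by rewrite ler_pdivrMr ?pochhammer_gt0 // mul1r ler_pochhammer.
rewrite sum_fact_div_pochhammer // gerBl mulr_ge0 ?divr_ge0 ?pochhammer_ge0 ?(ltW b0) //.
- by have := ler0n R N; lra.
- by rewrite subr_ge0 ltW.
Qed.

(** Almost surely f and its absolute value both equal g, so one finite integral gives integrability
    and the expectation. It carries moments of positive parts back to the original variables. *)
Lemma ae_eq_Lfun1 (d : measure_display) (T : measurableType d) (R : realType)
    (P : probability T R) (f g : T -> R) (N : set T) (r : R) :
  measurable_fun setT f -> measurable_fun setT g -> (forall w, 0 <= g w) ->
  P.-negligible (~` N) -> (forall w, N w -> f w = g w) ->
  (\int[P]_w (g w)%:E = r%:E)%E ->
  f \in Lfun P 1 /\ ('E_P[f] = r%:E)%E.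
Proof.
move=> mf mg g0 N0 fg gr.
have E : ae_eq P setT (EFin \o f) (EFin \o g).
  by apply: negligibleS N0 => w /= nfg Nw; apply: nfg => _; rewrite fg.
have E' : ae_eq P setT (abse \o (EFin \o f)) (EFin \o g).
  apply: negligibleS N0 => w /= nfg Nw; apply: nfg => _.
  by rewrite fg // ger0_norm.
have mEf : measurable_fun setT (EFin \o f) by exact/measurable_EFinP.
have mEg : measurable_fun setT (EFin \o g) by exact/measurable_EFinP.
split; last first.
  by rewrite unlock (ae_eq_integral (EFin \o g) (EFin \o f) measurableT mEf mEg E).
apply/Lfun1_integrable/integrableP; split => //.
rewrite (ae_eq_integral (EFin \o g) (abse \o (EFin \o f)) measurableT _ mEg E') //.
  by rewrite gr ltry.
exact: measurableT_comp.
Qed.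

(** * Integrals of the survival functions *)

Lemma integral_survival_betaprime (R : realType) (a s : R) : 1 < a -> 0 < s ->
  (\int[lebesgue_measure]_(x in `[0%R, +oo[) ((1 + x / s) `^ (- a))%:E
   = (s / (a - 1))%:E)%E.
Proof.
move=> a1 s0; rewrite [RHS](_ : _ = (s * (0`!%:R / ((a - 1) * pochhammer a 0)))%:E).
  rewrite -integral_betaprime //; apply: eq_integral => x _.
  by rewrite /betaprime expr0 mul1r addr0.
by rewrite /pochhammer big_ord0 fact0 mulr1 mul1r.
Qed.

Lemma measurable_betaprime (R : realType) (a s : R) m : 0 < s ->
  measurable_fun (`[0%R, +oo[ : set R) (fun x => betaprime a m (x / s)).
Proof.
move=> s0; apply: subspace_continuous_measurable_fun => //.
apply: derivable_within_continuous => x; rewrite in_itv /= andbT => x0.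
exact: derivable_betaprime_scaled.
Qed.

(** All terms are nonnegative, so sum and integral may be exchanged twice, first for y and then for
    x. *)
Lemma integral2_survival (R : realType) (g a b s t : R) :
  0 <= g -> g <= a -> 1 < a -> 2 < b -> 0 < s -> 0 < t ->
  (\int[lebesgue_measure]_(x in `[0%R, +oo[) \int[lebesgue_measure]_(y in `[0%R, +oo[)
     ((1 + x / s) `^ (- a) * (1 + y / t) `^ (- b)
      * (1 - x / s / (1 + x / s) * (y / t / (1 + y / t))) `^ (- g))%:E
   = (s * t / ((a - 1) * (b - 1)) * hypergeom [:: g; 1; 1] [:: a; b] 1)%:E)%E.
Proof.
move=> g0 ga a1 b2 s0 t0.
have a0 : 0 < a by exact: lt_trans a1.
have b1 : 1 < b by rewrite (lt_trans _ b2) // ltr1n.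
have b0 : 0 < b by exact: lt_trans b2.
(* The value of the Beta integral in y. *)
pose H m := t * (m`!%:R / ((b - 1) * pochhammer b m)).
have div0 (x r : R) : 0 < r -> x \in `[0, +oo[ -> 0 <= x / r.
  by move=> r0; rewrite in_itv /= andbT => x0; rewrite divr_ge0 // ltW.
have H0 m : 0 <= H m.
  by rewrite !mulr_ge0 ?invr_ge0 ?mulr_ge0 ?pochhammer_ge0 ?subr_ge0 ?ltW.
transitivity (\int[lebesgue_measure]_(x in `[0%R, +oo[)
    \sum_(m <oo) (negbin g m * H m * betaprime a m (x / s))%:E)%E.
  apply: eq_integral => x; rewrite inE /= => x0.
  under eq_integral => y yD.
    rewrite -nneseries_negbin_betaprime //; last 2 first.
    - exact: div0.
    - by apply: div0 => //; rewrite inE in yD.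
    over.
  rewrite /= integral_nneseries //.
  - apply: eq_eseriesr => m _.
    under eq_integral do rewrite EFinM.
    rewrite ge0_integralZl ?integral_betaprime //.
    + by rewrite -EFinM; congr (_%:E); rewrite -/(H m); ring.
    + by apply/measurable_EFinP; apply: measurable_betaprime.
    + by move=> y y0; rewrite lee_fin betaprime_ge0 // div0.
    + by rewrite lee_fin mulr_ge0 ?negbin_ge0 // betaprime_ge0 // div0.
  - move=> m; apply/measurable_EFinP/measurable_funM => //.
    exact: measurable_betaprime.
  - move=> m y y0; rewrite lee_fin mulr_ge0 //; last by rewrite betaprime_ge0 ?div0.
    by apply: mulr_ge0; [exact: negbin_ge0|rewrite betaprime_ge0 ?div0].
transitivity (\sum_(m <oo) \int[lebesgue_measure]_(x in `[0%R, +oo[)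
    (negbin g m * H m * betaprime a m (x / s))%:E)%E.
  apply: integral_nneseries => // [m|m y y0].
    by apply/measurable_EFinP/measurable_funM => //; exact: measurable_betaprime.
  rewrite lee_fin; apply: mulr_ge0; last by rewrite betaprime_ge0 ?div0.
  by rewrite mulr_ge0 ?negbin_ge0.
apply/cvg_lim => //.
  rewrite (_ : (fun N => _) = EFin \o (fun N => s * t / ((a - 1) * (b - 1)) *
      \sum_(0 <= m < N) hypergeom_term [:: g; 1; 1] [:: a; b] 1 m)); last first.
    apply/funext => N; rewrite /= mulr_sumr -sumEFin; apply: eq_bigr => m _.
    under eq_integral do rewrite EFinM.
    rewrite ge0_integralZl ?integral_betaprime //.
    + rewrite -EFinM; congr (_%:E); rewrite hypergeom_term_3F2 /H /negbin; field.
      rewrite !subr_eq0 !gt_eqF ?pochhammer_gt0 //.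
    + by apply/measurable_EFinP; apply: measurable_betaprime.
    + by move=> y y0; rewrite lee_fin betaprime_ge0 // div0.
    + by rewrite lee_fin mulr_ge0 ?negbin_ge0.
  (* [hypergeom] is a real limit, so convergence of its partial sums is required before embedding it
     in the extended reals. *)
  apply: cvg_EFin; [exact: nearW|apply: cvgMl_tmp].
  exact: is_cvg_hypergeom_3F2.
Qed.

(** * Moments of the multivariate Pareto law *)

Section pareto_moments.
Context (R : realType) (n : nat) (c : 'M[bool]_(n, n.+1)).
Context (sigma : 'I_n -> R) (gamma : 'I_n.+1 -> R).
Hypothesis sigma_gt0 : forall i, 0 < sigma i.
Hypothesis gamma_gt0 : forall j, 0 < gamma j.
Context (d : measure_display) (T : measurableType d) (P : probability T R).
Variable X : 'I_n -> {RV P >-> R}.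
Hypothesis survivalX : forall x : 'I_n -> R, (forall i, 0 < x i) ->
  P (upper_orthant X x) = (pareto_survival c sigma gamma x)%:E.

Let gam k := \sum_(j < n.+1) (c k j)%:R * gamma j.
Let gam2 k l := \sum_(j < n.+1) (c k j)%:R * (c l j)%:R * gamma j.
(* The X_i are only almost surely positive, whereas the tail formula for the
   expectation wants nonnegative variables. *)
Let Y i : {RV P >-> R} := (X i)^\+.
Let pos := upper_orthant X (fun=> 0).

Let pareto_survival0 : pareto_survival c sigma gamma (fun=> 0) = 1.
Proof.
rewrite /pareto_survival big1 // => j _.
by rewrite big1 ?addr0 ?powR1 // => i _; rewrite mulr0.
Qed.

Let pos_negligible : P.-negligible (~` pos).
Proof.
apply: (upper_orthant0_negligible survivalX) => // x x0.
exact: cvg_pareto_survival.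
Qed.

Let YE i w : pos w -> X i w = Y i w.
Proof. by move=> /(_ i) Xi; rewrite /Y /= /funrpos max_l // ltW. Qed.

Let Y_ge0 i w : 0 <= Y i w.
Proof. exact: funrpos_ge0. Qed.

(** Evaluate the joint law at s in place k, t in place l and 0 elsewhere; on [pos] the zero
    coordinates impose no condition. *)
Lemma pospart_pair_survival k l (s t : R) : k != l -> 0 <= s -> 0 <= t ->
  P [set w | s < Y k w /\ t < Y l w] =
  ((1 + s / sigma k) `^ (- gam k) * (1 + t / sigma l) `^ (- gam l) *
   (1 - s / sigma k / (1 + s / sigma k)
      * (t / sigma l / (1 + t / sigma l))) `^ (- gam2 k l))%:E.
Proof.
move=> kl s0 t0; rewrite -pareto_survival_pair //.
apply: (survival_pospart survivalX) => //.
- by move=> x x0; exact: cvg_pareto_survival.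
- rewrite (_ : [set w | _] = [set w | s < Y k w] `&` [set w | t < Y l w]) //.
  by apply: measurableI; exact: measurable_strict_supset.
- by move=> i; case: ifP => // _; case: ifP.
- move=> w w0; rewrite /= -(YE k w0) -(YE l w0); split => [[sX tX] i|h].
    by case: eqP => [->//|_]; case: eqP => [->//|_]; exact: w0.
  by have := h k; have := h l; rewrite eqxx (eq_sym l k) (negbTE kl) eqxx.
Qed.

(** The marginal tail of [Y k] is the pair formula at t = 0, since [Y l] is almost surely
    positive. *)
Lemma pospart_expectation k l : k != l -> 1 < gam k ->
  (\int[P]_w (Y k w)%:E = (sigma k / (gam k - 1))%:E)%E.
Proof.
move=> kl gk1; rewrite -integral_survival_betaprime // -expectation_def.
rewrite ge0_expectation_ccdf //; apply: eq_integral => s.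
rewrite inE /= in_itv /= andbT => s0.
have := pospart_pair_survival kl s0 (lexx 0).
rewrite !mul0r mulr0 addr0 subr0 !powR1 !mulr1 => <-.
rewrite /ccdf /distribution /pushforward.
have -> : Y k @^-1` `]s, +oo[ = [set w | s < Y k w].
  by apply/seteqP; split => w /=; rewrite in_itv /= andbT.
rewrite (measureDI P (measurable_strict_supset (Y k) s)
  (measurable_strict_supset (Y l) 0)).
rewrite [X in (X + _)%E](_ : _ = 0%E) ?add0e //.
apply: measure_negligible.
  by apply: measurableD; exact: measurable_strict_supset.
apply: negligibleS pos_negligible => w /= [_ Yl0 w0]; apply: Yl0.
by rewrite -YE.
Qed.

Lemma pospart_expectationM k l : k != l -> 1 < gam k -> 2 < gam l ->
  (\int[P]_w (Y k w * Y l w)%:E = (sigma k * sigma l / ((gam k - 1) * (gam l - 1))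
     * hypergeom [:: gam2 k l; 1; 1] [:: gam k; gam l] 1)%:E)%E.
Proof.
move=> kl gk gl; rewrite -integral2_survival //; last 2 first.
- by apply: sumr_ge0 => j _; rewrite !mulr_ge0 // ltW.
(* The entry c l j is 0 or 1, so each summand of [gam2 k l] is at most the one of [gam k]. *)
- apply: ler_sum => j _; rewrite ler_wpM2r ?(ltW (gamma_gt0 j)) //.
  by rewrite -[leRHS]mulr1 ler_wpM2l // lern1 leq_b1.
rewrite integralM_joint_ccdf //.
apply: eq_integral => s; rewrite inE /= in_itv /= andbT => s0.
apply: eq_integral => t; rewrite inE /= in_itv /= andbT => t0.
exact: pospart_pair_survival.
Qed.

(** The product of the two means equals the prefactor of the mixed moment, which accounts for the -1
    next to the series. *)
Lemma pareto_covariance k l : k != l -> 2 < gam k -> 2 < gam l ->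
  covariance P (X k) (X l) =
  (sigma k * sigma l / ((gam k - 1) * (gam l - 1))
     * (hypergeom [:: gam2 k l; 1; 1] [:: gam k; gam l] 1 - 1))%:E.
Proof.
move=> kl gk gl.
have [gk1 gl1] : 1 < gam k /\ 1 < gam l.
  by split; [apply: lt_trans gk|apply: lt_trans gl]; rewrite ltr1n.
have [LX EX] := ae_eq_Lfun1 (measurable_funPT (X k)) (measurable_funPT (Y k))
  (Y_ge0 k) pos_negligible (fun w => @YE k w) (pospart_expectation kl gk1).
have lk : l != k by rewrite eq_sym.
have [LX' EX'] := ae_eq_Lfun1 (measurable_funPT (X l)) (measurable_funPT (Y l))
  (Y_ge0 l) pos_negligible (fun w => @YE l w) (pospart_expectation lk gl1).
have [LXX EXX] := ae_eq_Lfun1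
  (measurable_funM (measurable_funPT (X k)) (measurable_funPT (X l)))
  (measurable_funM (measurable_funPT (Y k)) (measurable_funPT (Y l)))
  (fun w => mulr_ge0 (Y_ge0 k w) (Y_ge0 l w)) pos_negligible
  (fun w w0 => congr2 *%R (YE k w0) (YE l w0)) (pospart_expectationM kl gk1 gl).
rewrite covarianceE // EX EX' [X in (X - _)%E]EXX -EFinM -EFinB; congr (_%:E).
by field; rewrite !subr_eq0 !gt_eqF.
Qed.

End pareto_moments.

Unset Implicit Arguments.

Theorem theorem3p1 (R : realType) (n : nat) (hn : (2 <= n)%N)
  (c : 'M[bool]_(n, n.+1)) (sigma : 'I_n -> R) (gamma : 'I_n.+1 -> R)
  (hsigma : forall i, 0 < sigma i) (hgamma : forall j, 0 < gamma j)
  (d : measure_display) (T : measurableType d) (P : probability T R)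
  (X : 'I_n -> {RV P >-> R})
  (hX : forall x : 'I_n -> R, (forall i, 0 < x i) ->
     P [set w | forall i, x i < X i w] =
     (\prod_(j < n.+1)
        (1 + \sum_(i < n) (c i j)%:R / sigma i * x i) `^ (- gamma j))%:E)
  (k l : 'I_n) (hkl : k != l)
  (hk : 2 < \sum_(j < n.+1) (c k j)%:R * gamma j)
  (hl : 2 < \sum_(j < n.+1) (c l j)%:R * gamma j) :
  let gk := \sum_(j < n.+1) (c k j)%:R * gamma j in
  let gl := \sum_(j < n.+1) (c l j)%:R * gamma j in
  let gkl := \sum_(j < n.+1) (c k j)%:R * (c l j)%:R * gamma j in
  covariance P (X k) (X l) =
  (sigma k * sigma l / ((gk - 1) * (gl - 1))
     * (hypergeom [:: gkl; 1; 1] [:: gk; gl] 1 - 1))%:E.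
Proof. exact: (pareto_covariance hsigma hgamma hX hkl hk hl). Qed.
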